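(* Let $n=1$, let $\mu$ be a Young diagram with $p_i\ge1$ for all $1\le i\le g$, let $p\in{\mathcal P}(\mu)$ and $l\ge1$. Write $T_l^t(p)=x_1(t)\otimes\cdots\otimes x_L(t)$. Let $y_0(t)\in B^{1,l}$ be the carrier inducing $T_l$ on $T_l^t(p)$, i.e. the unique element $v$ with $v\otimes T_l^t(p)\simeq T_l^{t+1}(p)\otimes v$, and let the carrier $y_k(t)$ at position $k$ be defined by $y_0(t)\otimes x_1(t)\otimes\cdots\otimes x_k(t)\simeq x_1(t+1)\otimes\cdots\otimes x_k(t+1)\otimes y_k(t)$; identify $y_k(t)$ with the number of letters $2$ (balls) in it. Let ${\mathcal N}_l$ be the smallest positive integer with $T_l^{{\mathcal N}_l}(p)=p$ and $\langle y_k\rangle_l=\frac{1}{{\mathcal N}_l}\sum_{t=0}^{{\mathcal N}_l-1}y_k(t)$. Then the time average of the number of balls in the carrier with capacity $l$ at position $k$ under $T_l$ is $$\langle y_k\rangle_l={}^t{\bf h}_lB^{-1}{\bf h}_\infty.$$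
   Context: Fix $L\ge1$ and $n=1$. For $l\ge1$ let $B^{1,l}$ be the set of one-row semistandard tableaux of length $l$ with entries in $\{1,2\}$; $B^{1,1}=\{1,2\}$. For a semistandard tableau $T$ and a letter $x$, $T\leftarrow x$ denotes Schensted row insertion ($x$ bumps the smallest entry of the first row strictly larger than $x$, the bumped entry is inserted into the next row, and so on; if there is no such entry the letter is appended at the end of the row), and $x\rightarrow T$ denotes column insertion ($x$ bumps the smallest entry of the first column that is $\ge x$, the bumped entry is inserted into the next column, and so on; if there is no such entry the letter is appended at the bottom of the column). The combinatorial $R$ is the bijection $B^{1,l}\otimes B^{1,1}\to B^{1,1}\otimes B^{1,l}$, $b\otimes c\simeq c'\otimes b'$ iff $(c\rightarrow b)=(b'\leftarrow c')$ ($\otimes$ is a formal Cartesian product). The local energy $H(b\otimes c)$ is $0$ if this common tableau has shape $(l+1)$ and $1$ if it has shape $(l,1)$. A path is $p=b_1\otimes\cdots\otimes b_L\in(B^{1,1})^{\otimes L}$. For $v\in B^{1,l}$ put $v_0=v$ and $v_{k-1}\otimes b_k\simeq b'_k\otimes v_k$, $e_k=H(v_{k-1}\otimes b_k)$, and write $v\otimes b_1\otimes\cdots\otimes b_k\simeq b'_1\otimes\cdots\otimes b'_k\otimes v_k$. The path $p$ is $T_l$-evolvable if there is $v$ with $v_L=v$ and $b'_1\otimes\cdots\otimes b'_L$ and all $e_k$ are the same for all such $v$; then $T_l(p)=b'_1\otimes\cdots\otimes b'_L$ and $E_l(p)=\sum_ke_k$. It is evolvable if it is $T_l$-evolvable for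 all $l\ge1$. For a Young diagram $\mu$, let $l_1>\cdots>l_g\ge1$ be its distinct row lengths, $m_i$ the number of rows of length $l_i$, and $p_i=L-2\sum_{j=1}^g\min(l_i,l_j)m_j$. ${\mathcal P}(\mu)$ is the set of evolvable paths with at least as many letters $1$ as letters $2$ and with $E_l(p)=\sum_{i=1}^g\min(l,l_i)m_i$ for all $l\ge1$. (It is known that the condition $p_i\ge1$ for all $i$ guarantees that the carrier inducing $T_l$ exists uniquely.) Put $H=\{(i,\alpha)\mid1\le i\le g,\ 1\le\alpha\le m_i\}$, $B=(\delta_{ij}\delta_{\alpha\beta}p_i+2\min(l_i,l_j))_{(i,\alpha),(j,\beta)\in H}$, ${\bf h}_l=(\min(l,l_i))_{(i,\alpha)\in H}$, ${\bf h}_\infty=(l_i)_{(i,\alpha)\in H}$. *)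

(* Defs.v *)
From HB Require Import structures.
From mathcomp Require Import all_boot all_order all_algebra.
Set Implicit Arguments.
Unset Strict Implicit.
Unset Printing Implicit Defensive.
Import Order.TTheory GRing.Theory Num.Theory.

(* The element i of 'I_2 stands for the letter i + 1. *)
Definition letter := 'I_2.
Definition one : letter := ord0.
Definition two : letter := ord_max.

(* A tableau is the sequence of its rows, from top to bottom. *)
Definition tableau := seq (seq letter).

(* Conjugation turns the sequence of rows of a tableau into the sequence of
   its columns, and conversely. *)
Definition conj_tab (T : tableau) : tableau :=
  mkseq (fun j => pmap (fun r => onth r j) T) (size (head [::] T)).

(* The lines (rows or columns) being monotone, the first y with r x y is the
   smallest one, and it is the one which is bumped. *)
Fixpoint insert_lines (r : rel letter) (T : tableau) (x : letter) : tableau :=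
  if T is s :: T' then
    let i := find (r x) s in
    if i < size s then set_nth x s i x :: insert_lines r T' (nth x s i)
    else rcons s x :: T'
  else [:: [:: x]].

Definition row_insert (T : tableau) (x : letter) : tableau :=
  insert_lines (fun a b : letter => a < b) T x.

Definition col_insert (x : letter) (T : tableau) : tableau :=
  conj_tab (insert_lines (fun a b : letter => a <= b) (conj_tab T) x).

(* B^{1,l}; the factor B^{1,1} is identified with the type of letters. *)
Definition row_tab (l : nat) :=
  {b : l.-tuple letter | sorted (fun x y : letter => x <= y) b}.

Definition rowseq (l : nat) (b : row_tab l) : seq letter := val (val b).

Definition balls (l : nat) (b : row_tab l) : nat := count_mem two (rowseq b).

(* combR b c = (c', b') when b (x) c ~ c' (x) b'. The default value is never
   used: see combRE below. *)
Definition combR (l : nat) (b : row_tab l) (c : letter) : letter * row_tab l :=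
  odflt (c, b) [pick x : letter * row_tab l |
    col_insert c [:: rowseq b] == row_insert [:: rowseq x.2] x.1].

(* The only possible shapes are (l + 1) and (l, 1). *)
Definition energy (l : nat) (b : row_tab l) (c : letter) : nat :=
  if shape (col_insert c [:: rowseq b]) == [:: l.+1] then 0 else 1.

(* transport v s = (s', w) when v (x) s ~ s' (x) w. *)
Fixpoint transport (l : nat) (v : row_tab l) (s : seq letter) :
    seq letter * row_tab l :=
  if s is c :: s1 then
    let x := combR v c in
    let y := transport x.2 s1 in
    (x.1 :: y.1, y.2)
  else ([::], v).

Fixpoint energies (l : nat) (v : row_tab l) (s : seq letter) : seq nat :=
  if s is c :: s1 then energy v c :: energies (combR v c).2 s1 else [::].

Definition periodic_carrier (l : nat) (p : seq letter) (v : row_tab l) : bool :=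
  (transport v p).2 == v.

Definition T_evolvable (l : nat) (p : seq letter) : Prop :=
  (exists v : row_tab l, periodic_carrier p v) /\
  (forall v w : row_tab l, periodic_carrier p v -> periodic_carrier p w ->
     (transport v p).1 = (transport w p).1 /\ energies v p = energies w p).

Definition evolvable (p : seq letter) : Prop :=
  forall l : nat, 1 <= l -> T_evolvable l p.

(* T_l and E_l, meaningful only when p is T_l-evolvable. *)
Definition T_ (l : nat) (p : seq letter) : seq letter :=
  if [pick v : row_tab l | periodic_carrier p v] is Some v
  then (transport v p).1 else p.

Definition E_ (l : nat) (p : seq letter) : nat :=
  if [pick v : row_tab l | periodic_carrier p v] is Some v
  then sumn (energies v p) else 0.

(* A Young diagram is the nonincreasing sequence of its positive row lengths. *)
Definition young (mu : seq nat) : bool := sorted geq mu && (0 \notin mu).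

Definition g_ (mu : seq nat) : nat := size (undup mu).

Definition len (mu : seq nat) (i : 'I_(g_ mu)) : nat := nth 0 (undup mu) i.

Definition mult (mu : seq nat) (i : 'I_(g_ mu)) : nat := count_mem (len i) mu.

Definition vacancy (L : nat) (mu : seq nat) (i : 'I_(g_ mu)) : int :=
  (L%:Z - (2 * \sum_(j < g_ mu) minn (len i) (len j) * mult j)%N%:Z)%R.

Definition in_P (L : nat) (mu : seq nat) (p : L.-tuple letter) : Prop :=
  [/\ evolvable p,
      count_mem two p <= count_mem one p &
      forall l : nat, 1 <= l ->
        E_ l p = \sum_(i < g_ mu) minn l (len i) * mult i].

(* The index set of pairs (i, alpha); matrices over it are numbered through
   enum_val. *)
Definition Hset (mu : seq nat) : finType := {i : 'I_(g_ mu) & 'I_(mult i)}.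

Definition Hlen (mu : seq nat) (a : 'I_#|Hset mu|) : nat :=
  len (tag (enum_val a)).

Definition Bmat (L : nat) (mu : seq nat) : 'M[rat]_#|Hset mu| :=
  (\matrix_(a, b) (((a == b)%:R * (vacancy L (tag (enum_val a)))%:~R)
                   + (2 * minn (Hlen a) (Hlen b))%N%:R))%R.

Definition h_ (mu : seq nat) (l : nat) : 'cV[rat]_#|Hset mu| :=
  (\col_a (minn l (Hlen a))%:R)%R.

Definition h_oo (mu : seq nat) : 'cV[rat]_#|Hset mu| :=
  (\col_a (Hlen a)%:R)%R.

Definition least_period (S : Type) (f : S -> S) (x : S) (N : nat) : Prop :=
  [/\ 0 < N, iter N f x = x &
      forall M : nat, 0 < M -> iter M f x = x -> N <= M].

(* The defining property of the combinatorial R. *)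

Section CombRSpec.

Let le : rel letter := fun a b => a <= b.
Let std i j : seq letter := nseq i one ++ nseq j two.
Let sing (c : letter) := [:: c].

Lemma letterP (c : letter) : c = one \/ c = two.
Proof. by case: c => [[|[|k]]] // H; [left | right]; apply/val_inj. Qed.

Lemma sorted_std (s : seq letter) :
  sorted le s -> exists i j, s = std i j.
Proof.
elim: s => [|c s IH] H; first by exists 0, 0.
have [i [j Es]] := IH (path_sorted H).
case: (letterP c) => Ec; first by exists i.+1, j; rewrite Es Ec.
suff Ei : i = 0 by exists 0, j.+1; rewrite Es Ec Ei.
by case: i Es => // i Es; move: H; rewrite Es Ec.
Qed.

Lemma std_sorted i j : sorted le (std i j).
Proof.
have S2 k : path le two (nseq k two) by elim: k.
case: i => [|i]; first by case: j => //= k; apply: S2.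
rewrite /std /=; elim: i => [|i IH] //=.
by case: j => //= k; apply: S2.
Qed.

Lemma std_inj i j i' j' : std i j = std i' j' -> i = i' /\ j = j'.
Proof.
move=> E; have := congr1 (count_mem one) E.
have := congr1 (count_mem two) E.
by rewrite !count_cat !count_nseq /= !mul0n !mul1n !addn0.
Qed.

Lemma rcons_nseq (c : letter) j : rcons (nseq j c) c = nseq j.+1 c.
Proof. by elim: j => //= j ->. Qed.

Lemma row_insert_two i j : row_insert [:: std i j] two = [:: std i j.+1].
Proof.
rewrite /row_insert /= hasNfind ?ltnn; last first.
  by rewrite has_cat !has_nseq /= !andbF.
by rewrite /std rcons_cat rcons_nseq.
Qed.

Lemma row_insert_one0 i : row_insert [:: std i 0] one = [:: std i.+1 0].
Proof.
rewrite /row_insert /= hasNfind ?ltnn; last first.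
  by rewrite has_cat !has_nseq /= !andbF.
by rewrite /std !cats0 rcons_nseq.
Qed.

Lemma row_insert_one i j :
  row_insert [:: std i j.+1] one = [:: std i.+1 j; [:: two]].
Proof.
rewrite /row_insert /=; set f := find _ _.
have Ef : f = i.
  rewrite /f /std find_cat has_nseq /= andbF size_nseq /=.
  by rewrite addn0.
rewrite Ef size_cat !size_nseq addnS ltnS leq_addr.
rewrite nth_cat size_nseq ltnn subnn /= -/(std _ _); congr [:: _; _].
by rewrite /std; elim: i {f Ef} => //= i ->.
Qed.

Lemma pmap_sing0 (s : seq letter) :
  pmap (fun r : seq letter => onth r 0) (map sing s) = s.
Proof. by elim: s => //= c s ->. Qed.

Lemma pmap_sing1 (s : seq letter) :
  pmap (fun r : seq letter => onth r 1) (map sing s) = [::].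
Proof. by elim: s. Qed.

Lemma conj_row (s : seq letter) : conj_tab [:: s] = map sing s.
Proof.
rewrite /conj_tab /=; apply: (@eq_from_nth _ [::]).
  by rewrite size_mkseq size_map.
move=> k; rewrite size_mkseq => lt_k.
rewrite nth_mkseq // (nth_map one) //= /sing.
by rewrite (onthE s) (nth_map one).
Qed.

Lemma conj_sing (c : letter) s : conj_tab (map sing (c :: s)) = [:: c :: s].
Proof. by rewrite /conj_tab /= /mkseq /= pmap_sing0. Qed.

Lemma col_insert_one i j : col_insert one [:: std i j] = [:: std i.+1 j].
Proof.
have I2 k : insert_lines le (map sing (nseq k two)) two
            = map sing (nseq k.+1 two) by elim: k => //= k ->.
rewrite /col_insert conj_row -/le.
suff -> : insert_lines le (map sing (std i j)) one = map sing (std i.+1 j).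
  exact: conj_sing.
elim: i => [|i /= -> //]; case: j => //= j.
by rewrite I2.
Qed.

Lemma col_insert_two0 j : col_insert two [:: std 0 j] = [:: std 0 j.+1].
Proof.
rewrite /col_insert conj_row -/le.
suff -> : insert_lines le (map sing (std 0 j)) two = map sing (std 0 j.+1).
  exact: conj_sing.
by elim: j => //= j ->.
Qed.

Lemma col_insert_two i j :
  col_insert two [:: std i.+1 j] = [:: std i.+1 j; [:: two]].
Proof.
rewrite /col_insert conj_row -/le /=.
by rewrite /conj_tab /= /mkseq /= pmap_sing0 pmap_sing1.
Qed.

Lemma row_tab_std l (b : row_tab l) :
  exists i j, rowseq b = std i j /\ i + j = l.
Proof.
have [i [j E]] := sorted_std (valP b); exists i, j; split => //.
by rewrite -(size_tuple (val b)) E size_cat !size_nseq.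
Qed.

Lemma std_row_tab l i j : i + j = l -> exists b : row_tab l, rowseq b = std i j.
Proof.
move=> E; have S : size (std i j) == l by rewrite size_cat !size_nseq E.
by exists (exist _ (Tuple S) (std_sorted i j)).
Qed.

Lemma combR_exists l (b : row_tab l) (c : letter) :
  exists x : letter * row_tab l,
    col_insert c [:: rowseq b] = row_insert [:: rowseq x.2] x.1.
Proof.
have [i [j [Eb El]]] := row_tab_std b; rewrite Eb.
case: (letterP c) => ->.
  case: j Eb El => [|j] Eb El.
    by exists (one, b); rewrite /= Eb col_insert_one row_insert_one0.
  have [|b' Eb'] := @std_row_tab l i.+1 j; first by rewrite addSnnS.
  by exists (two, b'); rewrite /= Eb' col_insert_one row_insert_two.
case: i Eb El => [|i] Eb El.
  by exists (two, b); rewrite /= Eb col_insert_two0 row_insert_two.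
have [|b' Eb'] := @std_row_tab l i j.+1; first by rewrite -addSnnS.
by exists (one, b'); rewrite /= Eb' col_insert_two row_insert_one.
Qed.

Lemma row_insert_inj l (x y : letter * row_tab l) :
  row_insert [:: rowseq x.2] x.1 = row_insert [:: rowseq y.2] y.1 -> x = y.
Proof.
case: x y => [c b] [c' b'] /=.
have [i [j [Eb El]]] := row_tab_std b.
have [i' [j' [Eb' El']]] := row_tab_std b'.
suff main : row_insert [:: std i j] c = row_insert [:: std i' j'] c' ->
    [/\ c = c', i = i' & j = j'].
  rewrite Eb Eb' => /main[-> Ei Ej]; congr (_, _).
  by apply/val_inj/val_inj; rewrite -!/(rowseq _) Eb Eb' Ei Ej.
case: (letterP c) => ->; case: (letterP c') => ->;
  case: j {Eb El} => [|j]; case: j' {Eb' El'} => [|j'];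
  rewrite ?row_insert_two ?row_insert_one0 ?row_insert_one // => E;
  have {E} := congr1 (head [::]) E; rewrite [head _ _]/= [RHS]/=;
  by case/std_inj => Ei Ej; split; congruence.
Qed.

Lemma combRE l (b : row_tab l) (c c' : letter) (b' : row_tab l) :
  combR b c = (c', b') <->
  col_insert c [:: rowseq b] = row_insert [:: rowseq b'] c'.
Proof.
rewrite /combR; case: pickP => [x /eqP Ex | no] /=; last first.
  by have [x Ex] := combR_exists b c; have := no x; rewrite Ex eqxx.
split=> [Exy | ]; first by rewrite Ex Exy.
by rewrite Ex => /(@row_insert_inj _ x (c', b')).
Qed.

End CombRSpec.

(* Main.v *)
Require Import Defs.
From HB Require Import structures.
From mathcomp Require Import all_boot all_order all_algebra.
From mathcomp Require Import zify ring lra.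
Set Implicit Arguments.
Unset Strict Implicit.
Unset Printing Implicit Defensive.
Import Order.TTheory GRing.Theory Num.Theory.

(* Cut the cyclic path between blocks, so that it reads 1^(a_1) 2^(b_1) ...
   1^(a_n) 2^(b_n) with n = E_1 and all exponents positive. A carrier of capacity
   l changes the exponents in the same way as a carrier of capacity l - 1 does on
   the path with every exponent diminished by one, which is the path with the
   factors 12 eliminated and with the rows of mu shortened by one. Under T_l
   (respectively T_(l-1)) the beginning of a block moves by A + 1 (respectively
   A) sites, and both carriers leave its first run with the same load u. Hence,
   if M balls sit on L sites and c is the mean current,
     L c t = L U + M (X + t) + O(1),   (L - 2n) c' t = (L - 2n) U + (M - n) X + O(1)
   where X and U are the sums of A and u over t steps. The blocks keep their order,
   and the displacements of their beginnings add up to E_l at each step, so that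
   n (X + t) = E_l t + O(1). Eliminating U and X gives, with s = E_l / L,
     c = s + (1 - 2 s) (M - n) / (L - 2n) + c',
   and h_l^t B^-1 h_oo satisfies the same recursion in l. Finally, the O(1)
   error vanishes over periods, and the mean load of the carrier does not depend
   on the position because balls are conserved. *)

(** * The carrier as a bounded counter on boolean words *)

(* One letter passing a carrier of capacity l and load y (letter 2 is [true]):
   the new load, and the letter left behind. *)
Definition cload (l y : nat) (x : bool) : nat :=
  if x then (if y < l then y.+1 else y) else y.-1.

Definition cout (l y : nat) (x : bool) : bool := if x then l <= y else 0 < y.

Definition load (l : nat) : nat -> seq bool -> nat := foldl (cload l).

Fixpoint outp (l y : nat) (s : seq bool) : seq bool :=
  if s is x :: s1 then cout l y x :: outp l (cload l y x) s1 else [::].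

Fixpoint picks (l y : nat) (s : seq bool) : nat :=
  if s is x :: s1 then x && (y < l) + picks l (cload l y x) s1 else 0.

Fixpoint tot (l y : nat) (s : seq bool) : nat :=
  if s is x :: s1 then y + tot l (cload l y x) s1 else 0.

(* The moment of the balls: each one is weighted by the number of letters on its
   right. *)
Fixpoint wt (s : seq bool) : nat :=
  if s is x :: s1 then x * size s1 + wt s1 else 0.

Definition nb (s : seq bool) : nat := count id s.
Arguments nb : simpl never.

Definition light (s : seq bool) : bool := 2 * nb s < size s.

Lemma nb_cons x s : nb (x :: s) = x + nb s.
Proof. by []. Qed.

Lemma nb_cat s1 s2 : nb (s1 ++ s2) = nb s1 + nb s2.
Proof. exact: count_cat. Qed.

Lemma nb_nseq n (x : bool) : nb (nseq n x) = x * n.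
Proof. exact: count_nseq. Qed.

Lemma nb_rot k s : nb (rot k s) = nb s.
Proof. by rewrite -[in RHS](cat_take_drop k s) !nb_cat addnC. Qed.

Lemma light_rot k s : light (rot k s) = light s.
Proof. by rewrite /light nb_rot size_rot. Qed.

Lemma cload_le l y x : y <= l -> cload l y x <= l.
Proof. by rewrite /cload; case: x; first case: ifP; lia. Qed.

Lemma cload_cout l y x : cload l y x + cout l y x = y + x.
Proof. by rewrite /cload /cout; case: x; case: ltnP; lia. Qed.

Lemma cout_inv l y x :
  y <= l -> cout l (cload l y x) (cout l y x) = x /\
            cload l (cload l y x) (cout l y x) = y.
Proof.
rewrite /cload /cout; case: x => Hy.
  by case: (ltnP y l) => h /=; split => //; case: ltnP; lia.
case: (ltnP 0 y) => h /=; split; try case: ltnP; lia.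
Qed.

Lemma load_cat l y s1 s2 : load l y (s1 ++ s2) = load l (load l y s1) s2.
Proof. exact: foldl_cat. Qed.

Lemma outp_cat l y s1 s2 :
  outp l y (s1 ++ s2) = outp l y s1 ++ outp l (load l y s1) s2.
Proof. by elim: s1 y => //= x s1 IH y; rewrite IH. Qed.

Lemma picks_cat l y s1 s2 :
  picks l y (s1 ++ s2) = picks l y s1 + picks l (load l y s1) s2.
Proof. by elim: s1 y => //= x s1 IH y; rewrite IH addnA. Qed.

Lemma tot_cat l y s1 s2 :
  tot l y (s1 ++ s2) = tot l y s1 + tot l (load l y s1) s2.
Proof. by elim: s1 y => //= x s1 IH y; rewrite IH addnA. Qed.

Lemma wt_cat s1 s2 : wt (s1 ++ s2) = wt s1 + nb s1 * size s2 + wt s2.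
Proof. by elim: s1 => //= x s1 IH; rewrite IH nb_cons size_cat; lia. Qed.

Lemma size_outp l y s : size (outp l y s) = size s.
Proof. by elim: s y => //= x s IH y; rewrite IH. Qed.

Lemma load_le l y s : y <= l -> load l y s <= l.
Proof. by elim: s y => //= x s IH y Hy; apply/IH/cload_le. Qed.

Lemma load_nb l y s : load l y s + nb (outp l y s) = y + nb s.
Proof.
elim: s y => //= x s IH y; have := IH (cload l y x); have := cload_cout l y x.
rewrite !nb_cons; lia.
Qed.

Lemma picks_le l y s : picks l y s <= nb s.
Proof.
elim: s y => //= x s IH y; rewrite nb_cons leq_add //.
by case: x; case: (_ < _).
Qed.

Lemma picks0 y s : picks 0 y s = 0.
Proof. by elim: s y => //= x s IH y; rewrite IH ltn0 andbF. Qed.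

(** Summation by parts of ball conservation: the load at a site is [y] plus the balls read minus the
    balls left behind so far, and [wt] sums such counts over the sites. *)
Lemma tot_wt l y s : tot l y s + wt (outp l y s) = size s * y + wt s.
Proof.
elim: s y => //= x s IH y; have := IH (cload l y x); have := cload_cout l y x.
rewrite size_outp mulSn.
move: (cload l y x) (cout l y x) (tot _ _ _) (wt _) (size s) => a b c d e.
case: b x => [] [] /=; rewrite ?mul1n ?mul0n ?addn1 ?addn0; nia.
Qed.

Lemma wt_le s : wt s <= size s * size s.
Proof. by elim: s => //= x s IH; case: x; nia. Qed.

Lemma tot_sum l y s : tot l y s = \sum_(k < size s) load l y (take k s).
Proof.
elim: s y => [|x s IH] y /=; first by rewrite big_ord0.
by rewrite big_ord_recl /= IH.
Qed.

(** * Periodic carriers: uniqueness and existence *)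

Lemma cload_lip l y1 y2 x : y1 <= y2 <= l ->
  cload l y1 x <= cload l y2 x <= l /\ cload l y2 x + y1 <= cload l y1 x + y2.
Proof.
by rewrite /cload; case: x => H; [case: (ltnP y1 l); case: (ltnP y2 l)|]; lia.
Qed.

Lemma load_lip l y1 y2 s :
  y1 <= y2 <= l ->
  load l y1 s <= load l y2 s /\ load l y2 s + y1 <= load l y1 s + y2.
Proof.
elim: s y1 y2 => [|x s IH] y1 y2 H /=; first by lia.
by have [h0 h] := cload_lip x H; have [h1 h2] := IH _ _ h0; split; lia.
Qed.

(* The gap between two carriers can only stay constant if the larger one is
   never blocked. *)
Lemma load_rigid l y1 y2 s :
  y1 < y2 <= l -> load l y2 s + y1 = load l y1 s + y2 ->
  load l y2 s + size s = y2 + 2 * nb s.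
Proof.
elim: s y1 y2 => [|x s IH] y1 y2 H /=; first by rewrite /nb /=; lia.
have [|h0 h1] := @cload_lip l y1 y2 x; first by lia.
have [_ h3] := load_lip s h0.
move=> E; have E1 : cload l y2 x + y1 = cload l y1 x + y2 by lia.
have := IH (cload l y1 x) (cload l y2 x).
have : cload l y2 x + 1 = y2 + 2 * x.
  move: E1; rewrite /cload; case: x {h0 h1 h3 E} => /=; last by lia.
  by case: (ltnP y1 l); case: (ltnP y2 l); lia.
rewrite nb_cons; lia.
Qed.

(** Two distinct fixed loads keep a constant gap, so [load_rigid] would make half of the letters
    balls. *)
Lemma carrier_uniq l y1 y2 s : light s -> y1 <= l -> y2 <= l ->
  load l y1 s = y1 -> load l y2 s = y2 -> y1 = y2.
Proof.
rewrite /light; wlog : y1 y2 / y1 < y2 => [hw|lt_y] hs h1 h2 e1 e2.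
  by case: (ltngtP y1 y2) => // h; [|symmetry]; apply: hw.
have := @load_rigid l y1 y2 s; rewrite e1 e2; lia.
Qed.

(* The loads f^i(0) increase with i and are bounded by l, so that f^l(0) is a
   fixed point of f. *)
Definition car (l : nat) (s : seq bool) : nat := iter l (fun y => load l y s) 0.

Lemma car_iter_le l s i : iter i (fun y => load l y s) 0 <= l.
Proof. by elim: i => //= i; apply: load_le. Qed.

Lemma car_le l s : car l s <= l.
Proof. exact: car_iter_le. Qed.

Lemma car_fix l s : load l (car l s) s = car l s.
Proof.
set f := fun y => load l y s.
have fle := car_iter_le l s.
have mono i : iter i f 0 <= iter i.+1 f 0.
  elim: i => //= i IH; case: (@load_lip l (iter i f 0) (iter i.+1 f 0) s) => //.
  by rewrite IH fle.
have main i : iter i.+1 f 0 = iter i f 0 \/ i < iter i.+1 f 0.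
  elim: i => [|i [E|IH]]; first by rewrite /=; lia.
    by left; rewrite iterS E.
  by have := mono i.+1; rewrite leq_eqVlt => /orP[/eqP->|]; [left|lia].
by case: (main l) => // h; have := leq_trans h (fle l.+1); rewrite ltnn.
Qed.

Lemma car_eq l s y : light s -> y <= l -> load l y s = y -> car l s = y.
Proof. by move=> hs hy; apply: carrier_uniq hs (car_le _ _) hy (car_fix _ _). Qed.

(** * Cyclic evolution and its invariance under rotations *)

Definition evol (l : nat) (s : seq bool) : seq bool := outp l (car l s) s.
Definition energ (l : nat) (s : seq bool) : nat := picks l (car l s) s.
Definition curr (l : nat) (s : seq bool) : nat := tot l (car l s) s.

Lemma size_evol l s : size (evol l s) = size s.
Proof. exact: size_outp. Qed.

Lemma nb_evol l s : nb (evol l s) = nb s.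
Proof. by have := load_nb l (car l s) s; rewrite car_fix => /addnI. Qed.

Lemma light_evol l s : light (evol l s) = light s.
Proof. by rewrite /light size_evol nb_evol. Qed.

Section Iter.
Variables (l t : nat) (s : seq bool).

Lemma size_iter : size (iter t (evol l) s) = size s.
Proof. by elim: t => //= k <-; rewrite size_evol. Qed.

Lemma nb_iter : nb (iter t (evol l) s) = nb s.
Proof. by elim: t => //= k <-; rewrite nb_evol. Qed.

Lemma light_iter : light (iter t (evol l) s) = light s.
Proof. by rewrite /light size_iter nb_iter. Qed.

End Iter.

(** By uniqueness, the periodic carrier of the rotated word is the load that the original one has at
    the cut. *)
Lemma rot_invariance l k s : light s ->
  [/\ evol l (rot k s) = rot k (evol l s),
      energ l (rot k s) = energ l s & curr l (rot k s) = curr l s].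
Proof.
case: (leqP (size s) k) => [h|/ltnW hk hs].
  by rewrite !rot_oversize ?size_evol.
have ek : k = size (take k s) by rewrite size_takel.
rewrite -(cat_take_drop k s) in hs *; move: (take k s) (drop k s) ek hs => u v -> hs.
have := car_fix l (u ++ v); have le_y := car_le l (u ++ v).
rewrite /evol /energ /curr load_cat.
set y := car l (u ++ v) in le_y *; set w := load l y u => ew.
have cw : car l (v ++ u) = w.
  apply: car_eq; rewrite ?load_le // ?load_cat ?ew //.
  by rewrite -rot_size_cat light_rot.
rewrite rot_size_cat cw !(outp_cat, picks_cat, tot_cat) -/w ew.
split; try by rewrite addnC.
by rewrite -(size_outp l y u) rot_size_cat.
Qed.

Lemma evol_rot l k s : light s -> evol l (rot k s) = rot k (evol l s).
Proof. by move/(rot_invariance l k) => []. Qed.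

Lemma energ_rot l k s : light s -> energ l (rot k s) = energ l s.
Proof. by move/(rot_invariance l k) => []. Qed.

Lemma curr_rot l k s : light s -> curr l (rot k s) = curr l s.
Proof. by move/(rot_invariance l k) => []. Qed.

Lemma iter_rot l k t s : light s ->
  iter t (evol l) (rot k s) = rot k (iter t (evol l) s).
Proof. by move=> hs; elim: t => //= t ->; rewrite evol_rot ?light_iter. Qed.

(** * Invertibility of the evolution *)

Lemma outp_rev l y s : y <= l ->
  outp l (load l y s) (rev (outp l y s)) = rev s /\
  load l (load l y s) (rev (outp l y s)) = y.
Proof.
elim: s y => //= x s IH y le_y; have [e1 e2] := IH _ (cload_le x le_y).
rewrite !rev_cons -!cats1 outp_cat load_cat e1 e2 /=.
by have [-> ->] := cout_inv x le_y.
Qed.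

(* Time reversal: the local rule is an involution. *)
Lemma evol_rev l s : light s -> evol l (rev (evol l s)) = rev s.
Proof.
move=> hs; have [e1 e2] := outp_rev s (car_le l s).
rewrite car_fix in e1 e2; rewrite -/(evol _ _) in e1 e2.
rewrite {1}/evol (@car_eq _ _ (car l s)) ?car_le //.
by rewrite /light size_rev {1}/nb count_rev -/(nb _) -/(light _) light_evol.
Qed.

Lemma evol_inj l s1 s2 : light s1 -> light s2 -> evol l s1 = evol l s2 -> s1 = s2.
Proof.
move=> h1 h2 E; apply: (can_inj revK).
by rewrite -(evol_rev l h1) -(evol_rev l h2) E.
Qed.

(** * Passage through a run of equal letters *)

Lemma load_ones l y a : load l y (nseq a false) = y - a.
Proof. by elim: a y => [|a IH] y /=; [|rewrite IH]; lia. Qed.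

Lemma outp_ones l y a :
  outp l y (nseq a false) = nseq (minn a y) true ++ nseq (a - y) false.
Proof.
elim: a y => [|a IH] y /=; first by rewrite min0n.
rewrite IH; case: y => [|y] /=.
  by rewrite subn0.
by rewrite minnSS.
Qed.

Lemma picks_ones l y a : picks l y (nseq a false) = 0.
Proof. by elim: a y => //= a IH y; rewrite IH. Qed.

Lemma load_twos l y b : y <= l -> load l y (nseq b true) = minn (y + b) l.
Proof.
elim: b y => [|b IH] y h /=; first by lia.
by case: (ltnP y l) => h1; rewrite IH; lia.
Qed.

Lemma outp_twos l y b : y <= l ->
  outp l y (nseq b true)
  = nseq (minn b (l - y)) false ++ nseq (b - (l - y)) true.
Proof.
elim: b y => [|b IH] y h /=; first by rewrite min0n.
case: (ltnP y l) => h'; rewrite IH //.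
  by rewrite (_ : l - y = (l - y.+1).+1) ?minnSS; last lia.
have -> : l - y = 0 by lia.
by rewrite !minn0 !subn0.
Qed.

Lemma picks_twos l y b : y <= l -> picks l y (nseq b true) = minn b (l - y).
Proof.
elim: b y => [|b IH] y h /=; first by rewrite min0n.
by case: (ltnP y l) => h'; rewrite IH; lia.
Qed.

(** * Block form and elimination of the factors 12 *)

(* A pair (a, b) stands for the block 1^(a + e) 2^(b + e): passing from
   [word 1] to [word 0] eliminates the factors 12. *)
Definition word (e : nat) (ab : seq (nat * nat)) : seq bool :=
  flatten [seq nseq (q.1 + e) false ++ nseq (q.2 + e) true | q <- ab].

(* Passage of a carrier of capacity l and load z: within a block, minn a z
   balls are dropped, and minn b (l - (z - a)) balls are picked up. *)
Definition zstep (l z : nat) (q : nat * nat) : nat := minn (z - q.1 + q.2) l.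

Definition zend (l : nat) : nat -> seq (nat * nat) -> nat := foldl (zstep l).

Fixpoint drops (l z : nat) (ab : seq (nat * nat)) : nat :=
  if ab is q :: r then minn q.1 z + drops l (zstep l z q) r else 0.

Fixpoint pickups (l z : nat) (ab : seq (nat * nat)) : nat :=
  if ab is q :: r then minn q.2 (l - (z - q.1)) + pickups l (zstep l z q) r
  else 0.

Definition first_drop (z : nat) (ab : seq (nat * nat)) (c : nat) : nat :=
  if ab is q :: _ then minn q.1 z else c.

(* The blocks of the output, where the last block of twos is completed with c
   letters taken from the beginning of the output. *)
Fixpoint next_blocks (l z : nat) (ab : seq (nat * nat)) (c : nat) : seq (nat * nat) :=
  if ab is q :: r then
    (q.1 - z + minn q.2 (l - (z - q.1)),
     q.2 - (l - (z - q.1)) + first_drop (zstep l z q) r c)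
    :: next_blocks l (zstep l z q) r c
  else [::].

(* The sum over the blocks of their distances to the first one. *)
Fixpoint spread (ab : seq (nat * nat)) : nat :=
  if ab is q :: r then size r * (q.1 + q.2) + spread r else 0.

Lemma size_next_blocks l z ab c : size (next_blocks l z ab c) = size ab.
Proof. by elim: ab z => //= q r IH z; rewrite IH. Qed.

Lemma zstep_le l z q : zstep l z q <= l.
Proof. exact: geq_minr. Qed.

Lemma drops_pickups l z ab : z <= l ->
  pickups l z ab + z = drops l z ab + zend l z ab.
Proof.
elim: ab z => //= q r IH z le_z; have := IH _ (zstep_le l z q).
rewrite /zstep; lia.
Qed.

(** The beginning of each block moves by the number of balls dropped in it, so its distance to the
    first block changes by its own drop minus the first drop. *)
Lemma spread_next_blocks l z ab c :
  spread (next_blocks l z ab c) + size ab * first_drop z ab c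
  = spread ab + drops l z ab.
Proof.
elim: ab z => //= q r IH z; have := IH (zstep l z q).
rewrite size_next_blocks; set f := first_drop _ r c.
have : q.1 - z + minn q.2 (l - (z - q.1)) + (q.2 - (l - (z - q.1)) + f) + minn q.1 z
  = q.1 + q.2 + f by lia.
nia.
Qed.

Lemma word_cons e q r :
  word e (q :: r) = nseq (q.1 + e) false ++ nseq (q.2 + e) true ++ word e r.
Proof. by rewrite /word /= -catA. Qed.

Section Word.
Variables (e l : nat).

(** Between the two runs of a block the load is [z - q.1] whatever [e] is: the [e] extra ones absorb
    the [e] extra balls, and the [e] extra twos restore them. *)
Lemma load_word z ab : z <= l -> load (l + e) (z + e) (word e ab) = zend l z ab + e.
Proof.
elim: ab z => //= q r IH z le_z; rewrite word_cons !load_cat load_ones.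
rewrite load_twos; last by lia.
rewrite -IH ?zstep_le //; congr (load _ _ _); rewrite /zstep; lia.
Qed.

Lemma picks_word z ab : z <= l ->
  picks (l + e) (z + e) (word e ab) = pickups l z ab + e * size ab.
Proof.
elim: ab z => [|q r IH] z le_z; first by rewrite muln0.
rewrite word_cons !picks_cat picks_ones load_ones.
rewrite picks_twos ?load_twos; try by lia.
have -> : minn (z + e - (q.1 + e) + (q.2 + e)) (l + e) = zstep l z q + e.
  by rewrite /zstep; lia.
rewrite IH ?zstep_le //= mulnS; lia.
Qed.

(** The balls dropped in a block prolong the run of twos left over from the preceding block. The
    output is thus in block form after its initial run of twos, and the appended twos complete the
    last block. *)
Lemma outp_word z ab c : z <= l ->
  outp (l + e) (z + e) (word e ab) ++ nseq (c + e) true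
  = nseq (first_drop z ab c + e) true ++ word e (next_blocks l z ab c).
Proof.
elim: ab z => [|q r IH] z le_z; first by rewrite cats0.
rewrite !word_cons !outp_cat load_ones outp_ones.
rewrite outp_twos ?load_twos; try by lia.
have -> : minn (z + e - (q.1 + e) + (q.2 + e)) (l + e) = zstep l z q + e.
  by rewrite /zstep; lia.
rewrite -!catA IH ?zstep_le //=.
rewrite -addn_minl (_ : z + e - (q.1 + e) = z - q.1); last by lia.
rewrite (_ : l + e - (z - q.1) = l - (z - q.1) + e); last by lia.
by rewrite -addn_minl !subnDr !nseqD -!catA.
Qed.

Lemma nb_word ab : nb (word e ab) = nb (word 0 ab) + e * size ab.
Proof.
elim: ab => [|q r IH]; first by rewrite muln0.
rewrite !word_cons !nb_cat !nb_nseq IH /= mulnS; lia.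
Qed.

Lemma size_word ab : size (word e ab) = size (word 0 ab) + 2 * e * size ab.
Proof.
elim: ab => [|q r IH]; first by rewrite muln0.
rewrite !word_cons !size_cat !size_nseq IH /= mulnS; lia.
Qed.

(* Since the output starts with the balls dropped in the first block, a rotation
   brings it back to the form [word e _], and the variation of [wt] then
   measures the current. *)
Lemma step_word z ab : z <= l -> ab != [::] -> zend l z ab = z ->
  let A := first_drop z ab 0 in
  let ab1 := next_blocks l z ab A in
  let s := word e ab in
  rot (A + e) (outp (l + e) (z + e) s) = word e ab1 /\
  tot (l + e) (z + e) s + wt (word e ab1) + (A + e) * size s
  = size s * (z + e) + wt s + (A + e) * nb s.
Proof.
move=> le_z; case: ab => // q r _ ez A ab1 s.
have eA : first_drop z (q :: r) A = A by [].
set o := outp _ _ _.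
have [G eo] : exists G, o = nseq (A + e) true ++ G.
  rewrite /o /s word_cons outp_cat outp_ones /A /=.
  rewrite (_ : minn (q.1 + e) (z + e) = minn q.1 z + e); last by lia.
  by rewrite -catA; eexists.
have eG : G ++ nseq (A + e) true = word e ab1.
  have := outp_word (q :: r) A le_z; rewrite -/s -/o eo eA -catA.
  by move/eqP; rewrite eqseq_cat // eqxx => /eqP.
have es : size s = A + e + size G.
  by rewrite -(size_outp (l + e) (z + e) s) -/o eo size_cat size_nseq.
have en : nb s = A + e + nb G.
  have := load_nb (l + e) (z + e) s; rewrite -/o load_word // ez.
  by move/addnI => <-; rewrite eo nb_cat nb_nseq mul1n.
split; first by rewrite eo -[X in rot X](size_nseq (A + e) true) rot_size_cat.
have := tot_wt (l + e) (z + e) s; rewrite -/o eo -eG !wt_cat !nb_nseq !size_nseq.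
rewrite es en; nia.
Qed.

End Word.

Lemma light_word0 ab : light (word 1 ab) -> light (word 0 ab).
Proof. rewrite /light (nb_word 1) (size_word 1); lia. Qed.

Lemma zend_car l ab : zend l (car l (word 0 ab)) ab = car l (word 0 ab).
Proof. by have := load_word 0 ab (car_le l (word 0 ab)); rewrite !addn0 car_fix. Qed.

Lemma car_word e l ab : light (word e ab) ->
  car (l + e) (word e ab) = car l (word 0 ab) + e.
Proof.
move=> h; apply: car_eq => //; first by rewrite leq_add2r car_le.
by rewrite load_word ?car_le // zend_car.
Qed.

Lemma energ_word l ab : light (word 1 ab) ->
  energ l.+1 (word 1 ab) = size ab + energ l (word 0 ab).
Proof.
move=> h; have le_z := car_le l (word 0 ab).
rewrite /energ -addn1 car_word // picks_word // mul1n addnC.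
by have := picks_word 0 ab le_z; rewrite !addn0 => ->.
Qed.

(** * Rotating a light word into block form *)

Lemma rot_rotE (T : Type) (i j : nat) (s : seq T) :
  exists k, rot i (rot j s) = rot k s.
Proof.
rewrite (rot_minn j) (rot_minn i) size_rot rot_add_mod ?geq_minr //.
by eexists.
Qed.

Lemma rcons_true_word s : exists b ab, rcons s true = nseq b true ++ word 1 ab.
Proof.
elim: s => [|[] s [b [ab E]]] /=; first by exists 1, [::].
  by exists b.+1, ab; rewrite E.
case: b E => [|b] E; last by exists 0, ((0, b) :: ab); rewrite E word_cons !addn1.
case: ab E => [|q r] E; first by case: s E.
by exists 0, ((q.1.+1, q.2) :: r); rewrite E !word_cons.
Qed.

Lemma word_rcons ab q b :
  word 1 (rcons ab q) ++ nseq b true = word 1 (rcons ab (q.1, q.2 + b)).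
Proof.
elim: ab => [|q1 ab IH] /=; last by rewrite !word_cons -!catA IH.
rewrite !word_cons !cats0 -catA -nseqD /=.
by rewrite (_ : q.2 + 1 + b = q.2 + b + 1); last lia.
Qed.

(** One rotation puts a two at the end, and a second one moves the leading twos to the end, where
    they enlarge the last block. *)
Lemma light_word_exists s : light s -> 0 < nb s -> exists k ab, rot k s = word 1 ab.
Proof.
rewrite /nb -has_count => hs /hasP[[] // s_true _].
case/path.splitPr: s_true hs => u v hs.
have [k1 E1] : exists k, rcons (v ++ u) true = rot k (u ++ true :: v).
  by exists (size u).+1; rewrite -cat_rcons -(size_rcons u true) rot_size_cat rcons_cat.
have [b [ab E]] := rcons_true_word (v ++ u).
have [k2 E2] := rot_rotE b k1 (u ++ true :: v).
have E3 : rot k2 (u ++ true :: v) = word 1 ab ++ nseq b true.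
  by rewrite -E2 -E1 E -[X in rot X](size_nseq b true) rot_size_cat.
case: (lastP ab) E3 => [|r q] E3; last first.
  by exists k2, (rcons r (q.1, q.2 + b)); rewrite E3 word_rcons.
(* Without blocks the word would consist of twos only. *)
by move: hs; rewrite -(light_rot k2) E3 /light nb_nseq size_nseq /=; lia.
Qed.

Lemma energ_nb0 l s : nb s = 0 -> energ l s = 0.
Proof. by have := picks_le l (car l s) s; rewrite /energ; lia. Qed.

Lemma curr_nb0 l s : light s -> nb s = 0 -> curr l s = 0.
Proof.
move=> hs s0; have es : s = nseq (size s) false.
  by elim: s {hs} s0 => //= [[]] s IH; rewrite nb_cons //= add0n => /IH <-.
rewrite /curr (_ : car l s = 0); last by apply: car_eq => //; rewrite es load_ones.
by rewrite es; elim: (size s).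
Qed.

(** * Comparison of the capacities [l + 1] and [l]; conservation of the energy *)

Section Step.
Variables (l : nat) (ab : seq (nat * nat)).
Hypotheses (hl : light (word 1 ab)) (nz : ab != [::]).

(* The load u between the two runs of the first block is common to both
   carriers. *)
Lemma step_evol : exists ab1 A u,
  [/\ size ab1 = size ab,
      rot (A + 1) (evol l.+1 (word 1 ab)) = word 1 ab1 /\
      rot A (evol l (word 0 ab)) = word 0 ab1,
      curr l.+1 (word 1 ab) + wt (word 1 ab1)
      = size (word 1 ab) * u + wt (word 1 ab) + (A + 1) * nb (word 1 ab),
      curr l (word 0 ab) + wt (word 0 ab1)
      = size (word 0 ab) * u + wt (word 0 ab) + A * nb (word 0 ab) &
      spread ab1 + size ab * A = spread ab + energ l (word 0 ab)].
Proof.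
set z := car l (word 0 ab); have le_z : z <= l by apply: car_le.
have ez := zend_car l ab; set A := first_drop z ab 0.
have le_A : A <= z by rewrite /A; case: (ab) nz => // q r _; apply: geq_minr.
exists (next_blocks l z ab A), A, (z - A).
have [r1 c1] := step_word 1 le_z nz ez; have [r0 c0] := step_word 0 le_z nz ez.
rewrite -(car_word l hl) !addn1 in r1 c1; rewrite !addn0 in r0 c0.
rewrite -/A -/z in r1 c1 r0 c0.
have c1z : car l.+1 (word 1 ab) = z.+1 by rewrite -addn1 car_word // addn1.
split=> //.
- exact: size_next_blocks.
- by rewrite /evol addn1.
- rewrite /curr; move: c1; rewrite c1z addn1; nia.
- rewrite /curr -/z; move: c0; nia.
(* The carrier being periodic, the total drop equals the total pickup, which is the energy. *)
have := spread_next_blocks l z ab A; have := drops_pickups ab le_z.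
have := picks_word 0 ab le_z; rewrite !addn0 /energ -/z => ->.
have -> : first_drop z ab A = A by rewrite /A; case: (ab) nz.
rewrite ez -/z; lia.
Qed.

End Step.

(** Induction on the capacity: up to rotation, the evolution commutes with the elimination of the
    factors 12 and preserves the number of blocks. *)
Lemma energ_evol l s : light s -> energ l (evol l s) = energ l s.
Proof.
elim: l s => [|l IH] s hs; first by rewrite /energ !picks0.
have [s0|s_gt0] := posnP (nb s).
  by rewrite !energ_nb0 ?nb_evol.
have [k [ab E]] := light_word_exists hs s_gt0.
rewrite -(energ_rot _ k) ?light_evol // -evol_rot // -(energ_rot _ k hs) E.
have hw : light (word 1 ab) by rewrite -E light_rot.
have h0 := light_word0 hw.
have nz : ab != [::] by apply: contraTneq s_gt0 => e; rewrite -(nb_rot k) E e.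
have [ab1 [A [u [es [r1 r0] _ _ _]]]] := step_evol l hw nz.
have hw1 : light (word 1 ab1) by rewrite -r1 light_rot light_evol.
rewrite -(energ_rot _ (A + 1)) ?light_evol // r1 !energ_word // es -r0.
by rewrite energ_rot ?light_evol // IH.
Qed.

Lemma energ_iter l t s : light s -> energ l (iter t (evol l) s) = energ l s.
Proof. by move=> hs; elim: t => //= t IH; rewrite energ_evol ?light_iter. Qed.

(** Sum of [step_evol] over [t] steps. The two orbits are rotated differently but keep a common list
    of blocks, so the same [U] and [X] serve both. *)
Lemma orbit_word l ab t : light (word 1 ab) -> ab != [::] ->
  exists ab1 U X,
  [/\ size ab1 = size ab,
      (exists k, rot k (iter t (evol l.+1) (word 1 ab)) = word 1 ab1) /\
      (exists k, rot k (iter t (evol l) (word 0 ab)) = word 0 ab1),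
      \sum_(i < t) curr l.+1 (iter i (evol l.+1) (word 1 ab)) + wt (word 1 ab1)
      = size (word 1 ab) * U + wt (word 1 ab) + (X + t) * nb (word 1 ab),
      \sum_(i < t) curr l (iter i (evol l) (word 0 ab)) + wt (word 0 ab1)
      = size (word 0 ab) * U + wt (word 0 ab) + X * nb (word 0 ab) &
      spread ab1 + size ab * X = spread ab + t * energ l (word 0 ab)].
Proof.
move=> hw nz; have h0 := light_word0 hw; elim: t => [|t].
  exists ab, 0, 0; rewrite !big_ord0; split; try lia.
  by split; exists 0; rewrite rot0.
move=> [ab1 [U [X [es [[k1 e1] [k0 e0]] c1 c0 sp]]]].
have hw1 : light (word 1 ab1) by rewrite -e1 light_rot light_iter.
have nz1 : ab1 != [::] by rewrite -size_eq0 es size_eq0.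
have [ab2 [A [u [es2 [r1 r0] d1 d0 sp2]]]] := step_evol l hw1 nz1.
exists ab2, (U + u), (X + A); split; first by rewrite es2.
- rewrite !iterS; split.
    have [k E] := rot_rotE (A + 1) k1 (evol l.+1 (iter t (evol l.+1) (word 1 ab))).
    by exists k; rewrite -E -evol_rot ?light_iter // e1.
  have [k E] := rot_rotE A k0 (evol l (iter t (evol l) (word 0 ab))).
  by exists k; rewrite -E -evol_rot ?light_iter // e0.
- rewrite big_ord_recr /= -(curr_rot _ k1) ?light_iter // e1.
  have sz : size (word 1 ab1) = size (word 1 ab) by rewrite -e1 size_rot size_iter.
  have bz : nb (word 1 ab1) = nb (word 1 ab) by rewrite -e1 nb_rot nb_iter.
  rewrite sz bz in d1; move: c1 d1; move: (\sum_(i < t) _) (curr _ _) (size _) (nb _).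
  by move: (wt (word 1 ab)) (wt (word 1 ab1)) (wt (word 1 ab2)) => *; nia.
- rewrite big_ord_recr /= -(curr_rot _ k0) ?light_iter // e0.
  have sz : size (word 0 ab1) = size (word 0 ab) by rewrite -e0 size_rot size_iter.
  have bz : nb (word 0 ab1) = nb (word 0 ab) by rewrite -e0 nb_rot nb_iter.
  rewrite sz bz in d0; move: c0 d0; move: (\sum_(i < t) _) (curr _ _) (size _) (nb _).
  by move: (wt (word 0 ab)) (wt (word 0 ab1)) (wt (word 0 ab2)) => *; nia.
move: sp sp2; rewrite -e0 energ_rot ?light_iter // energ_iter // es; nia.
Qed.

(** * Positivity of the matrix of minima *)

Section Gram.
Local Open Scope ring_scope.
Variables (R : realFieldType) (H : finType) (lam : H -> nat).
Implicit Types phi p : H -> R.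

Let m a b : R := (minn (lam a) (lam b))%:R.

Lemma minn_sum (N x y : nat) : (x <= N)%N ->
  (minn x y)%:R = \sum_(j < N) (j < x)%:R * (j < y)%:R :> R.
Proof.
move=> le_x; have -> : minn x y = minn N (minn x y) by lia.
elim: N {le_x} => [|N IH]; first by rewrite big_ord0 min0n.
rewrite big_ord_recr /= -IH -!natrM -!natrD; congr _%:R.
by case: (ltnP N x); case: (ltnP N y); lia.
Qed.

(** The minimum of two row lengths counts their common columns, so the form is a sum of squares, one
    per column. *)
Lemma minn_gram_ge0 phi : 0 <= \sum_a \sum_b m a b * (phi a * phi b).
Proof.
pose N := (\sum_a lam a)%N.
have -> : \sum_a \sum_b m a b * (phi a * phi b)
          = \sum_(j < N) (\sum_a (j < lam a)%:R * phi a) ^+ 2.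
  under [RHS]eq_bigr => j _ do rewrite expr2 mulr_suml.
  rewrite [RHS]exchange_big; apply: eq_bigr => a _ /=.
  under [RHS]eq_bigr => j _ do rewrite mulr_sumr.
  rewrite [RHS]exchange_big; apply: eq_bigr => b _ /=.
  rewrite /m (@minn_sum N); last by rewrite /N (bigD1 a) //= leq_addr.
  by rewrite mulr_suml; apply: eq_bigr => j _; rewrite mulrACA.
by apply: sumr_ge0 => j _; apply: sqr_ge0.
Qed.

(** Pairing the equations with [phi] gives a vanishing sum of two nonnegative forms. Outside [P] the
    rows are empty, so [phi] enters there with coefficient 0. *)
Lemma minn_gram_inj (P : pred H) p phi :
  (forall a, P a -> 0 < p a) -> (forall a, ~~ P a -> lam a = 0%N) ->
  (forall a, P a -> p a * phi a + 2 * \sum_b m a b * phi b = 0) ->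
  forall a, P a -> phi a = 0.
Proof.
move=> p_gt0 lam0 eq0.
have E : \sum_(a | P a) p a * phi a ^+ 2
         + 2 * \sum_a \sum_b m a b * (phi a * phi b) = 0.
  rewrite [X in _ + 2 * X](bigID P) /= [X in _ + 2 * (_ + X)]big1 ?addr0.
    rewrite mulr_sumr -big_split big1 //= => a Pa.
    have -> : \sum_b m a b * (phi a * phi b) = phi a * \sum_b m a b * phi b.
      by rewrite mulr_sumr; apply: eq_bigr => b _; rewrite mulrCA.
    by rewrite expr2 mulrA mulrCA [X in X + _]mulrC -mulrDr eq0 ?mulr0.
  by move=> a nPa; rewrite big1 // => b _; rewrite /m lam0 // min0n mul0r.
have term_ge0 a : P a -> 0 <= p a * phi a ^+ 2.
  by move=> Pa; rewrite mulr_ge0 ?sqr_ge0 // ltW ?p_gt0.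
have sum_ge0 : 0 <= \sum_(a | P a) p a * phi a ^+ 2 by apply: sumr_ge0.
have {E} /eqP : \sum_(a | P a) p a * phi a ^+ 2 = 0.
  by have := minn_gram_ge0 phi; lra.
rewrite psumr_eq0 // => /allP E a Pa; have := E a (mem_index_enum _).
by rewrite Pa mulf_eq0 gt_eqF ?p_gt0 //= expf_eq0 /= => /eqP.
Qed.

End Gram.

Lemma curr_cap0 s : curr 0 s = 0.
Proof.
rewrite /curr (_ : car 0 s = 0); last by have := car_le 0 s; lia.
by elim: s => //= -[] s ->.
Qed.

(** * The linear system when all rows are shortened by one *)

Section Growth.
Local Open Scope ring_scope.
Variables (R : realFieldType) (H : finType).

(* The system B phi = h_l, without the rows of length 0 that appear once the
   rows of the diagram are shortened. *)
Definition soliton_eq (L l : nat) (lam : H -> nat) (phi : H -> R) : Prop :=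
  forall a, (0 < lam a)%N ->
    (L%:R - 2 * \sum_b (minn (lam a) (lam b))%:R) * phi a
    + 2 * \sum_b (minn (lam a) (lam b))%:R * phi b = (minn l (lam a))%:R.

Lemma soliton_eq0 L lam phi : (2 * \sum_a lam a < L)%N ->
  soliton_eq L 0 lam phi -> \sum_a (lam a)%:R * phi a = 0.
Proof.
move=> hL E; apply: big1 => a _; case: (posnP (lam a)) => [->|la].
  by rewrite mul0r.
rewrite (@minn_gram_inj R H lam (fun a => 0 < lam a)%N
  (fun a => L%:R - 2 * \sum_b (minn (lam a) (lam b))%:R) phi) ?mulr0 //.
- move=> b _; rewrite -natr_sum -natrM subr_gt0 ltr_nat.
  apply: leq_ltn_trans hL; rewrite leq_mul2l /=.
  by apply: leq_sum => c _; apply: geq_minr.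
- by move=> b; lia.
by move=> b lb; rewrite E // min0n.
Qed.

Section Reduce.
Variables (L l : nat) (lam : H -> nat) (phi : H -> R).
Hypothesis E : soliton_eq L l.+1 lam phi.

Let sig : R := \sum_b (minn 1 (lam b))%:R * phi b.
Let n : nat := \sum_a minn 1 (lam a).

(** In the sum of the equations over the nonempty rows, the double sums cancel by the symmetry of
    the minimum. *)
Lemma soliton_eq_total : L%:R * sig = (\sum_a minn l.+1 (lam a))%:R.
Proof.
have step a : (minn 1 (lam a))%:R * ((L%:R - 2 * \sum_b (minn (lam a) (lam b))%:R) * phi a
    + 2 * \sum_b (minn (lam a) (lam b))%:R * phi b) = (minn l.+1 (lam a))%:R :> R.
  case: (posnP (lam a)) => [->|la]; first by rewrite !minn0 mul0r.
  by rewrite E // (_ : minn 1 (lam a) = 1%N) ?mul1r //; lia.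
rewrite natr_sum -(eq_bigr _ (fun a _ => step a)) mulr_sumr.
have sym : \sum_a \sum_b (minn (lam a) (lam b))%:R * phi a
           = \sum_a \sum_b (minn (lam a) (lam b))%:R * phi b.
  by rewrite exchange_big; apply: eq_bigr => a _; apply: eq_bigr => b _; rewrite minnC.
apply/eqP; rewrite eq_sym -subr_eq0 -sumrB.
have -> : \sum_a ((minn 1 (lam a))%:R *
    ((L%:R - 2 * \sum_b (minn (lam a) (lam b))%:R) * phi a
      + 2 * \sum_b (minn (lam a) (lam b))%:R * phi b)
    - L%:R * ((minn 1 (lam a))%:R * phi a))
  = \sum_a (2 * (\sum_b (minn (lam a) (lam b))%:R * phi b)
            - 2 * \sum_b (minn (lam a) (lam b))%:R * phi a).
  apply: eq_bigr => a _; rewrite -mulr_suml.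
  case: (posnP (lam a)) => [->|la]; last first.
    by rewrite (_ : minn 1 (lam a) = 1%N); [ring|lia].
  have z f : \sum_b (minn 0 (lam b))%:R * f b = 0 :> R.
    by apply: big1 => b _; rewrite min0n mul0r.
  have := z (fun=> 1); under eq_bigr => b _ do rewrite mulr1.
  by rewrite minn0 z => ->; ring.
by rewrite sumrB -!mulr_sumr sym subrr.
Qed.

Let kap : R := (1 - 2 * sig) / (L%:R - 2 * n%:R).

Lemma soliton_mean_reduce :
  \sum_a (lam a)%:R * phi a
  = \sum_a ((lam a).-1)%:R * (phi a - kap) + sig
    + kap * (\sum_a (lam a).-1)%:R.
Proof.
rewrite natr_sum mulr_sumr /sig -!big_split; apply: eq_bigr => a _ /=.
have -> : (lam a)%:R = (lam a).-1%:R + (minn 1 (lam a))%:R :> R.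
  by rewrite -natrD; congr _%:R; lia.
ring.
Qed.

Hypothesis nL : (2 * n < L)%N.

(** The diagonal coefficients are unchanged, as [L] and twice the sum of minima both lose [2 * n].
    The left-hand side loses [2 * sig + (L - 2 * n) * kap], and [kap] is chosen to make this 1. *)
Lemma soliton_eq_reduce :
  soliton_eq (L - 2 * n) l (fun a => (lam a).-1) (fun a => phi a - kap).
Proof.
move=> a la; rewrite natrB ?natrM; last exact: ltnW.
have nz : L%:R - 2 * n%:R != 0 :> R.
  by rewrite subr_eq0 -natrM eqr_nat gtn_eqF.
have dec b : (minn (lam a).-1 (lam b).-1)%:R
             = (minn (lam a) (lam b))%:R - (minn 1 (lam b))%:R :> R.
  by rewrite -natrB; [congr _%:R|]; lia.
have -> : \sum_b (minn (lam a).-1 (lam b).-1)%:R * (phi b - kap)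
   = \sum_b (minn (lam a) (lam b))%:R * phi b - sig
     - kap * (\sum_b (minn (lam a) (lam b))%:R - n%:R).
  rewrite /n natr_sum -!sumrB mulr_sumr -sumrB; apply: eq_bigr => b _.
  by rewrite dec; ring.
have -> : \sum_b (minn (lam a).-1 (lam b).-1)%:R
   = \sum_b (minn (lam a) (lam b))%:R - n%:R :> R.
  by rewrite /n natr_sum -sumrB; apply: eq_bigr => b _.
have -> : (minn l (lam a).-1)%:R = (minn l.+1 (lam a))%:R - 1 :> R.
  by rewrite -[1]/(1%:R) -natrB; [congr _%:R|]; lia.
rewrite -E; last by lia.
move: (\sum_b _) (\sum_b _) => x y; rewrite /kap; field; exact: nz.
Qed.

End Reduce.

Lemma sum_minnS (lam : H -> nat) j :
  (\sum_a minn j.+1 (lam a) = \sum_a minn 1 (lam a) + \sum_a minn j (lam a).-1)%N.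
Proof. by rewrite -big_split; apply: eq_bigr => a _ /=; lia. Qed.

Lemma sum_pred (lam : H -> nat) :
  (\sum_a lam a = \sum_a minn 1 (lam a) + \sum_a (lam a).-1)%N.
Proof. by rewrite -big_split; apply: eq_bigr => a _ /=; lia. Qed.

End Growth.

(** * Growth of the accumulated current *)

Lemma spread_le ab : spread ab <= size ab * size (word 0 ab).
Proof.
elim: ab => //= q r IH; rewrite word_cons !size_cat !size_nseq; nia.
Qed.

Section Growth.
Local Open Scope ring_scope.
Variable R : realFieldType.

(** Elimination of [U] and [X]: what remains on the right is a multiple of the error of the
    shortened path, plus three boundary terms that will be bounded uniformly in time. *)
Lemma growth_identity (L n M S S0 w1 w1' w0 w0' sp sp' U X t E0 c0 sig : R) :
  n != 0 -> L - 2 * n != 0 ->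
  S + w1' = L * U + w1 + (X + t) * M ->
  S0 + w0' = (L - 2 * n) * U + w0 + X * (M - n) ->
  sp' + n * X = sp + t * E0 ->
  L * sig = E0 + n ->
  S - L * (c0 + sig + (1 - 2 * sig) / (L - 2 * n) * (M - n)) * t
  = L / (L - 2 * n) * (S0 - (L - 2 * n) * c0 * t)
    + L / (L - 2 * n) * (w0' - w0) - (w1' - w1)
    + (M - L * (M - n) / (L - 2 * n)) / n * (sp - sp').
Proof.
move=> nzn nzL0 e1 e2 e3 e4.
have -> : S = L * U + w1 + (X + t) * M - w1' by rewrite -e1; ring.
have -> : S0 = (L - 2 * n) * U + w0 + X * (M - n) - w0' by rewrite -e2; ring.
have -> : sp = sp' + n * X - t * (L * sig - n) by rewrite e3 e4; ring.
by field; rewrite nzn nzL0.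
Qed.

Lemma dist_le (a b Q : R) : 0 <= a <= Q -> 0 <= b <= Q -> `|a - b| <= Q.
Proof. by move=> ha hb; rewrite ler_norml; lra. Qed.

(** Induction on the capacity: the ball count, the energies and the linear system all pass to the
    path without its factors 12 and to the shortened rows. *)
Lemma current_growth (H : finType) (l : nat) (s : seq bool) (lam : H -> nat)
    (phi : H -> R) :
  light s -> nb s = (\sum_a lam a)%N ->
  (forall j, energ j s = (\sum_a minn j (lam a))%N) ->
  soliton_eq (size s) l lam phi ->
  exists K : R, forall t : nat,
    `|(\sum_(i < t) curr l (iter i (evol l) s))%:R
      - (size s)%:R * (\sum_a (lam a)%:R * phi a) * t%:R| <= K.
Proof.
elim: l s lam phi => [|l IH] s lam phi hs es hE hphi.
  exists 0 => t; rewrite big1 ?(soliton_eq0 _ hphi) => [||i _].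
  - by rewrite mulr0 mul0r subr0 normr0.
  - by rewrite -es.
  by rewrite curr_cap0.
(* A path without balls has no block form, but its current vanishes and all its rows are empty. *)
have [s0|s_gt0] := posnP (nb s).
  exists 0 => t; rewrite big1 => [|i _]; last first.
    by rewrite curr_nb0 ?light_iter ?nb_iter.
  rewrite big1 => [|a _]; first by rewrite mulr0 mul0r subr0 normr0.
  move: s0; rewrite es => /eqP; rewrite sum_nat_eq0 => /forallP/(_ a)/eqP ->.
  by rewrite mul0r.
have [k [ab E]] := light_word_exists hs s_gt0.
have hw : light (word 1 ab) by rewrite -E light_rot.
have h0 := light_word0 hw.
have nz : ab != [::] by apply: contraTneq s_gt0 => e; rewrite -(nb_rot k) E e.
have hE1 j : energ j (word 1 ab) = (\sum_a minn j (lam a))%N.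
  by rewrite -E energ_rot.
have en : (\sum_a minn 1 (lam a))%N = size ab.
  by rewrite -hE1 energ_word // /energ picks0 addn0.
have sz : size s = (size (word 0 ab) + 2 * size ab)%N.
  by rewrite -(size_rot k) E (size_word 1) muln1.
have bz : nb s = (nb (word 0 ab) + size ab)%N.
  by rewrite -(nb_rot k) E (nb_word 1) mul1n.
have n_gt0 : (0 < size ab)%N by rewrite lt0n size_eq0.
have nL : (2 * \sum_a minn 1 (lam a) < size s)%N.
  by move: h0; rewrite /light; lia.
pose sig : R := \sum_b (minn 1 (lam b))%:R * phi b.
pose kap : R := (1 - 2 * sig) / ((size s)%:R - 2 * (size ab)%:R).
have [||||K0 IHK] := IH (word 0 ab) (fun a => (lam a).-1) (fun a => phi a - kap).
- by [].
- by move: bz; rewrite es sum_pred; lia.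
- by move=> j; have := hE1 j.+1; rewrite energ_word // sum_minnS; lia.
- have := soliton_eq_reduce hphi nL; rewrite -/sig en -/kap.
  by rewrite (_ : (size s - 2 * size ab)%N = size (word 0 ab)); last lia.
pose Q : R := (size s * size s)%:R.
pose r : R := (size s)%:R / ((size s)%:R - 2 * (size ab)%:R).
pose d : R := ((nb s)%:R - (size s)%:R * ((nb s)%:R - (size ab)%:R)
               / ((size s)%:R - 2 * (size ab)%:R)) / (size ab)%:R.
(* One summand for each term on the right of [growth_identity]; [Q] bounds all the moments and
   spreads. *)
exists (r * K0 + r * Q + Q + `|d| * Q) => t.
have [ab1 [U [X [es1 [[k1 e1] [k0 e0]] c1 c0 sp]]]] := orbit_word l t hw nz.
have sz1 : size (word 1 ab1) = size s by rewrite -e1 size_rot size_iter -E size_rot.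
have sz0 : size (word 0 ab1) = size (word 0 ab) by rewrite -e0 size_rot size_iter.
have rat0 (i j : nat) : (i <= size s * size s)%N -> (j <= size s * size s)%N ->
    `|i%:R - j%:R| <= Q.
  by move=> hi hj; apply: dist_le; rewrite ler0n ler_nat.
have sum_rot : (\sum_(i < t) curr l.+1 (iter i (evol l.+1) s)
    = \sum_(i < t) curr l.+1 (iter i (evol l.+1) (word 1 ab)))%N.
  by apply: eq_bigr => i _; rewrite -E iter_rot // curr_rot ?light_iter.
have sz1' : size (word 1 ab) = size s by rewrite -E size_rot.
have bz1' : nb (word 1 ab) = nb s by rewrite -E nb_rot.
rewrite sz1' bz1' -sum_rot in c1.
have L0E : (size (word 0 ab))%:R = (size s)%:R - 2 * (size ab)%:R :> R.
  by rewrite sz natrD natrM; ring.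
have M0E : (nb (word 0 ab))%:R = (nb s)%:R - (size ab)%:R :> R.
  by rewrite bz natrD; ring.
have L0_gt0 : 0 < (size s)%:R - 2 * (size ab)%:R :> R.
  by rewrite -L0E ltr0n; move: h0; rewrite /light; lia.
have -> : \sum_a (lam a)%:R * phi a
   = \sum_a ((lam a).-1)%:R * (phi a - kap) + sig
     + (1 - 2 * sig) / ((size s)%:R - 2 * (size ab)%:R) * ((nb s)%:R - (size ab)%:R).
  rewrite (soliton_mean_reduce (size s)) en -/sig -/kap -M0E.
  by congr (_ + _ * _%:R); move: bz; rewrite es sum_pred; lia.
rewrite (@growth_identity _ _ _ _ (\sum_(i < t) curr l (iter i (evol l) (word 0 ab)))%:R
  (wt (word 1 ab))%:R (wt (word 1 ab1))%:R (wt (word 0 ab))%:R (wt (word 0 ab1))%:R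
  (spread ab)%:R (spread ab1)%:R U%:R X%:R _ (energ l (word 0 ab))%:R).
- rewrite -/r -/d -L0E; have r_ge0 : 0 <= r by rewrite divr_ge0 // ltW.
  apply: le_trans (ler_normD _ _) _; apply: lerD; last first.
    rewrite normrM ler_wpM2l //; apply: rat0; apply: leq_trans (spread_le _) _.
      by rewrite leq_mul //; lia.
    by rewrite es1 sz0 leq_mul //; lia.
  apply: le_trans (ler_normB _ _) _; apply: lerD; last first.
    by apply: rat0; apply: leq_trans (wt_le _) _; rewrite ?sz1 ?sz1'.
  apply: le_trans (ler_normD _ _) _; apply: lerD.
    by rewrite normrM ger0_norm // ler_wpM2l.
  rewrite normrM ger0_norm // ler_wpM2l //; apply: rat0.
    by apply: leq_trans (wt_le _) _; rewrite sz0 leq_mul //; lia.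
  by apply: leq_trans (wt_le _) _; rewrite leq_mul //; lia.
- by rewrite pnatr_eq0 -lt0n.
- by rewrite gt_eqF.
- by rewrite -!natrD -!natrM -!natrD; congr _%:R.
- by rewrite -L0E -M0E -!natrM -!natrD; congr _%:R.
- by rewrite -!natrM -!natrD; congr _%:R.
(* [sig] is the energy at capacity [l + 1] divided by the length. *)
rewrite /sig (soliton_eq_total hphi) -hE -(energ_rot _ k hs) E energ_word //.
by rewrite natrD addrC.
Qed.
End Growth.

(** * Large capacities, periodicity and exact averages *)

(** Each elimination lowers the capacity by one and removes at least one ball. This will identify
    the number of balls with the size of the diagram. *)
Lemma energ_nb l s : light s -> nb s <= l -> energ l s = nb s.
Proof.
have [m] := ubnP (nb s); elim: m s l => // m IH s l lt_m hs le_l.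
have [s0|s_gt0] := posnP (nb s); first by rewrite s0 energ_nb0.
have [k [ab E]] := light_word_exists hs s_gt0.
have hw : light (word 1 ab) by rewrite -E light_rot.
have nz : 0 < size ab.
  by rewrite lt0n size_eq0; apply: contraTneq s_gt0 => e; rewrite -(nb_rot k) E e.
have bz : nb s = nb (word 0 ab) + size ab by rewrite -(nb_rot k) E (nb_word 1) mul1n.
case: l le_l => [|l] le_l; first by lia.
rewrite -(energ_rot _ k) // E energ_word // IH ?light_word0 //; lia.
Qed.

(** The carrier is never empty when it meets a one, nor full when it meets a two. *)
Lemma free_carrier l y s : size s <= y -> y + size s <= l ->
  picks l y s = nb s /\ load l y s + size s = y + 2 * nb s.
Proof.
elim: s y => [|x s IH] y /= h1 h2; first by rewrite /nb /=; lia.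
have [||-> ] := IH (cload l y x); rewrite ?nb_cons.
- by rewrite /cload; case: x => /=; [case: ltnP|]; lia.
- by rewrite /cload; case: x => /=; [case: ltnP|]; lia.
rewrite /cload; case: x => /=; last by lia.
by case: ltnP; lia.
Qed.

(** An injective map on the finite set of light words of a given length permutes it. *)
Lemma iter_evol_period l s : light s -> exists2 N, 0 < N & iter N (evol l) s = s.
Proof.
move=> hs; pose T := {x : (size s).-tuple bool | light x}.
have sz (u : T) : size (evol l (val (val u))) == size s.
  by rewrite size_evol size_tuple.
have lt (u : T) : light (Tuple (sz u)) by rewrite /= light_evol (valP u).
pose f (u : T) : T := exist _ (Tuple (sz u)) (lt u).
have f_inj : injective f.
  move=> u v /(congr1 (fun w : T => tval (val w))) /= E.
  by apply/val_inj/val_inj/(evol_inj (valP u) (valP v) E).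
pose s0 : T := exist _ (in_tuple s) hs.
exists (fingraph.order f s0); first exact: fingraph.order_gt0.
have it n : tval (val (iter n f s0)) = iter n (evol l) s.
  by elim: n => //= n ->.
by rewrite -it (fingraph.iter_order f_inj).
Qed.

Lemma take_outp l y k s : take k (outp l y s) = outp l y (take k s).
Proof. by elim: s k y => [|x s IH] [|k] y //=; rewrite IH. Qed.

Section Period.
Variables (l N : nat) (s : seq bool).
Hypotheses (hs : light s) (perN : iter N (evol l) s = s).

Let x t := iter t (evol l) s.
Let y k t := load l (car l (x t)) (take k (x t)).

(* The number of balls between the positions 0 and k is periodic in time. *)
Lemma mean_load_const k : \sum_(t < N) y k t = \sum_(t < N) y 0 t.
Proof.
have cons t : y k t + nb (take k (x t.+1)) = y 0 t + nb (take k (x t)).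
  by rewrite /x iterS {2}/evol take_outp load_nb /y take0.
have : \sum_(t < N) (y k t + nb (take k (x t.+1)))
       = \sum_(t < N) (y 0 t + nb (take k (x t))).
  by apply: eq_bigr => t _.
rewrite !big_split /=; suff -> : \sum_(t < N) nb (take k (x t.+1))
    = \sum_(t < N) nb (take k (x t)) by move/addIn.
have shift n (f : nat -> nat) :
    \sum_(t < n) f t.+1 + f 0 = \sum_(t < n) f t + f n.
  by elim: n => [|n IH]; rewrite ?big_ord0 // !big_ord_recr /= addnAC IH.
by have := shift N (fun t => nb (take k (x t))); rewrite (_ : x N = x 0) // => /addIn.
Qed.

Lemma sum_curr k : \sum_(t < N) curr l (x t) = size s * \sum_(t < N) y k t.
Proof.
transitivity (\sum_(t < N) \sum_(j < size s) y j t).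
  by apply: eq_bigr => t _; rewrite /curr tot_sum size_iter.
rewrite exchange_big /= (eq_bigr (fun=> \sum_(t < N) y k t)) ?sum_nat_const ?card_ord //.
by move=> j _; rewrite !mean_load_const.
Qed.

Lemma sum_curr_period m :
  \sum_(t < m * N) curr l (x t) = m * \sum_(t < N) curr l (x t).
Proof.
elim: m => [|m IH]; first by rewrite big_ord0.
rewrite mulSn big_split_ord /= mulSn -IH; congr (_ + _).
by apply: eq_bigr => t _; rewrite /x addnC iterD perN.
Qed.

Lemma mean_load (R : archiRealFieldType) (H : finType) (lam : H -> nat)
    (phi : H -> R) (k : nat) :
  nb s = \sum_a lam a -> (forall j, energ j s = \sum_a minn j (lam a)) ->
  soliton_eq (size s) l lam phi ->
  ((\sum_(t < N) y k t)%:R = N%:R * \sum_a (lam a)%:R * phi a)%R.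
Proof.
move=> es hE hphi; have [K hK] := current_growth hs es hE hphi.
set c := (\sum_a _)%R in hK *; set Y := \sum_(t < N) _.
have s_neq0 : ((size s)%:R != 0 :> R)%R.
  by rewrite pnatr_eq0 -lt0n; move: hs; rewrite /light; lia.
apply/eqP; rewrite -subr_eq0; apply/eqP; set D := (_ - _)%R.
(* Over [m] periods the discrepancy is [m] times that of one period, yet it stays below [K], so it
   is 0 by the Archimedean property. *)
have bound m : (m%:R * `|(size s)%:R * D| <= K)%R.
  have := hK (m * N); rewrite sum_curr_period (sum_curr k) -/Y !natrM.
  suff -> : (m%:R * ((size s)%:R * Y%:R) - (size s)%:R * c * (m%:R * N%:R)
             = m%:R * ((size s)%:R * D))%R.
    by rewrite normrM ger0_norm.
  by rewrite /D; ring.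
apply/eqP; apply: contraT => D_neq0; exfalso.
have d_gt0 : (0 < `|(size s)%:R * D|)%R by rewrite normr_gt0 mulf_neq0.
have K_ge0 : (0 <= K)%R by have := bound 0; rewrite mul0r.
have := archi_boundP (divr_ge0 K_ge0 (ltW d_gt0)).
by rewrite ltr_pdivrMr // ltNge bound.
Qed.

End Period.

(** * From tableaux to boolean words *)

Definition ball (c : letter) : bool := c == two.

Lemma ball_inj : injective ball.
Proof. by move=> c d; case: (letterP c) (letterP d) => -> [] ->. Qed.

Section Carrier.
Variable l : nat.
Implicit Types v w : row_tab l.

Lemma ballsE v i j : rowseq v = nseq i Defs.one ++ nseq j two -> balls v = j.
Proof. by rewrite /balls => ->; rewrite count_cat !count_nseq mul0n mul1n. Qed.

Lemma balls_le v : balls v <= l.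
Proof. by have [i [j [/ballsE -> <-]]] := row_tab_std v; apply: leq_addl. Qed.

Lemma balls_inj : injective (@balls l).
Proof.
move=> v w; have [i [j [ev e1]]] := row_tab_std v.
have [i' [j' [ew e2]]] := row_tab_std w.
rewrite (ballsE ev) (ballsE ew) => E; apply/val_inj/val_inj.
by rewrite -!/(rowseq _) ev ew (_ : i = i') ?E //; lia.
Qed.

Lemma balls_surj b : b <= l -> exists v, balls v = b.
Proof.
move=> le_b; have [|v /ballsE] := @std_row_tab l (l - b) b; first by lia.
by exists v.
Qed.

(** By [combRE] it suffices to exhibit the image; the cases depend on whether the carrier contains a
    letter different from [c]. *)
Lemma combR_model v c :
  [/\ ball (combR v c).1 = cout l (balls v) (ball c),
      balls (combR v c).2 = cload l (balls v) (ball c) &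
      energy v c = ball c && (balls v < l)].
Proof.
have [i [j [ev el]]] := row_tab_std v; rewrite (ballsE ev) /energy ev.
case: (letterP c) => ->; rewrite /ball /=.
  rewrite col_insert_one /= size_cat !size_nseq.
  rewrite el eqxx; case: j ev el => [|j] ev el.
    rewrite (_ : combR v Defs.one = (Defs.one, v)) /= ?(ballsE ev) //.
    by apply/combRE; rewrite ev col_insert_one row_insert_one0.
  have [|w ew] := @std_row_tab l i.+1 j; first by lia.
  rewrite (_ : combR v Defs.one = (two, w)) /= ?(ballsE ew) //.
  by apply/combRE; rewrite ev ew col_insert_one row_insert_two.
case: i ev el => [|i] ev el.
  rewrite (_ : combR v two = (two, v)) /= ?(ballsE ev); last first.
    by apply/combRE; rewrite ev col_insert_two0 row_insert_two.
  rewrite col_insert_two0 /= size_nseq; rewrite add0n in el.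
  by rewrite el ltnn leqnn !eqxx.
have [|w ew] := @std_row_tab l i j.+1; first by lia.
rewrite col_insert_two (_ : combR v two = (Defs.one, w)) /= ?(ballsE ew); last first.
  by apply/combRE; rewrite ev ew col_insert_two row_insert_one.
have lt_jl : j < l by lia.
by rewrite leqNgt lt_jl eqseq_cons andbF.
Qed.

Lemma transport_model v s :
  [/\ map ball (transport v s).1 = outp l (balls v) (map ball s),
      balls (transport v s).2 = load l (balls v) (map ball s) &
      sumn (energies v s) = picks l (balls v) (map ball s)].
Proof.
elim: s v => //= c s IH v; have [e1 e2 e3] := combR_model v c.
by have [-> -> ->] := IH (combR v c).2; rewrite e1 e2 e3.
Qed.

Lemma periodic_carrierE s v :
  periodic_carrier s v = (load l (balls v) (map ball s) == balls v).
Proof.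
have [_ <- _] := transport_model v s.
by rewrite (inj_eq balls_inj).
Qed.

Lemma periodic_carrier_light s v : light (map ball s) ->
  periodic_carrier s v = (balls v == car l (map ball s)).
Proof.
move=> hs; rewrite periodic_carrierE; apply/eqP/eqP => [e|->].
  by rewrite (car_eq hs (balls_le v) e).
exact: car_fix.
Qed.

Lemma light_carrier s : light (map ball s) ->
  exists v, balls v = car l (map ball s) /\ periodic_carrier s =1 pred1 v.
Proof.
move=> hs; have [v ev] := balls_surj (car_le l (map ball s)).
exists v; split=> // w; rewrite periodic_carrier_light // -ev.
by rewrite /= (inj_eq balls_inj).
Qed.

Lemma light_T_evolvable s : light (map ball s) -> T_evolvable l s.
Proof.
move=> hs; have [v [_ pv]] := light_carrier hs; split.
  by exists v; rewrite pv /= eqxx.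
by move=> w1 w2; rewrite !pv => /eqP -> /eqP ->.
Qed.

Lemma light_T_E s : light (map ball s) -> exists v,
  [/\ balls v = car l (map ball s),
      unique (fun v => transport v s = (T_ l s, v)) v,
      map ball (T_ l s) = evol l (map ball s) &
      E_ l s = energ l (map ball s)].
Proof.
move=> hs; have [v [ev pv]] := light_carrier hs; exists v; split=> //.
- have pvv : (transport v s).2 = v by apply/eqP; rewrite -/(periodic_carrier _ _) pv /=.
  rewrite /T_; case: pickP => [w|/(_ v)]; rewrite pv /= ?eqxx // => /eqP ->.
  split=> [|u]; first by rewrite -{3}pvv; case: (transport v s).
  move=> eu; apply/eqP; rewrite eq_sym; have := pv u.
  by rewrite /periodic_carrier eu eqxx /= => <-.
- rewrite /T_; case: pickP => [w|/(_ v)]; rewrite pv /= ?eqxx // => /eqP ->.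
  by have [-> _ _] := transport_model v s; rewrite ev.
rewrite /E_; case: pickP => [w|/(_ v)]; rewrite pv /= ?eqxx // => /eqP ->.
by have [_ _ ->] := transport_model v s; rewrite ev.
Qed.

Lemma map_ball_T s : light (map ball s) -> map ball (T_ l s) = evol l (map ball s).
Proof. by case/light_T_E => v []. Qed.

Lemma map_ball_iter_T s t : light (map ball s) ->
  map ball (iter t (T_ l) s) = iter t (evol l) (map ball s).
Proof.
move=> hs; elim: t => //= t IH; rewrite map_ball_T ?IH //.
by rewrite light_iter.
Qed.

Lemma least_period_T s : light (map ball s) -> exists N,
  least_period (T_ l) s N /\ iter N (evol l) (map ball s) = map ball s.
Proof.
move=> hs; have [N0 N0_gt0 per0] := iter_evol_period l hs.
pose P N := (0 < N) && (iter N (T_ l) s == s).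
have exP : exists N, P N.
  exists N0; rewrite /P N0_gt0; apply/eqP/(inj_map ball_inj).
  by rewrite map_ball_iter_T.
case: (ex_minnP exP) => N /andP[N_gt0 /eqP perN] minN.
exists N; split; last by rewrite -map_ball_iter_T // perN.
by split=> // M M_gt0 perM; apply: minN; rewrite /P M_gt0 perM eqxx.
Qed.

End Carrier.

(** * The diagram and its matrix *)

Section Diagram.
Variables (L : nat) (mu : seq nat).

Lemma sum_Hset (f : nat -> nat) :
  \sum_a f (@Hlen mu a) = \sum_(i < g_ mu) f (len i) * mult i.
Proof.
rewrite (eq_bigr (fun i => \sum_(j < mult i) f (len i))) => [|i _]; last first.
  by rewrite sum_nat_const card_ord mulnC.
rewrite sig_big_dep /=.
by rewrite (reindex _ (onW_bij _ (@enum_val_bij (Hset mu)))).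
Qed.

Lemma vacancyE (i : 'I_(g_ mu)) :
  ((vacancy L i)%:~R
   = L%:R - 2 * \sum_(b < #|Hset mu|) (minn (len i) (Hlen b))%:R :> rat)%R.
Proof.
rewrite /vacancy -(sum_Hset (minn (len i))) rmorphB /= -!pmulrn natrM.
by rewrite natr_sum.
Qed.

Hypothesis vac_gt0 : forall i : 'I_(g_ mu), (1 <= vacancy L i)%R.

(** The vacancy number of the longest row is [L] minus twice the size of the diagram. *)
Lemma sum_Hlen_lt : 1 <= L -> 2 * \sum_a @Hlen mu a < L.
Proof.
move=> L_gt0; rewrite (sum_Hset id).
case: (posnP (g_ mu)) => [g0|g_gt0].
  rewrite big1 ?muln0 // => i _; have := ltn_ord i; lia.
case: (@arg_maxnP _ (Ordinal g_gt0) predT (@len mu)) => // i _ max_i.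
have := vac_gt0 i; rewrite /vacancy.
rewrite (eq_bigr (fun j => len j * mult j)) => [|j _]; last first.
  by rewrite (minn_idPr (max_i j isT)).
by move: (\sum_(j < g_ mu) _) => S; lia.
Qed.

(** The matrix is a positive diagonal plus twice a matrix of minima, so [minn_gram_inj] makes its
    kernel trivial. *)
Lemma Bmat_unit : Bmat L mu \in unitmx.
Proof.
rewrite -row_free_unit; apply: inj_row_free => v /rowP vB.
apply/rowP => a; rewrite mxE.
apply: (@minn_gram_inj rat _ (@Hlen mu) predT
  (fun a => (vacancy L (tag (enum_val a)))%:~R)%R (v ord0)) => //.
  by move=> b _; rewrite ltr0z; apply: lt_le_trans (vac_gt0 _).
move=> b _; have := vB b; rewrite [LHS]mxE [RHS]mxE => E; apply: etrans E.
rewrite [in RHS](bigD1 b) //= mxE eqxx.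
rewrite (bigD1 b) //= mulrDr addrA mulr_sumr mul1r mulrDr natrM.
congr (_ + _)%R; first by rewrite /Hlen; ring.
by apply: eq_bigr => c /negPf nbc; rewrite mxE nbc mul0r add0r minnC natrM; ring.
Qed.

Lemma Bmat_soliton_eq l :
  soliton_eq L l (@Hlen mu) (fun a => (invmx (Bmat L mu) *m h_ mu l)%R a ord0).
Proof.
move=> a _; set phi := (_ *m _)%R.
have : (Bmat L mu *m phi = h_ mu l)%R by rewrite /phi mulKVmx ?Bmat_unit.
move/matrixP/(_ a ord0); move: phi => phi; rewrite [LHS]mxE [RHS]mxE => <-.
rewrite -vacancyE -/(Hlen a).
transitivity (\sum_b ((a == b)%:R * (vacancy L (tag (enum_val a)))%:~R * phi b ord0
   + 2 * ((minn (Hlen a) (Hlen b))%:R * phi b ord0)))%R; last first.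
  by apply: eq_bigr => b _; rewrite mxE natrM; ring.
rewrite big_split /= -mulr_sumr; congr (_ + _)%R.
rewrite (bigD1 a) //= eqxx mul1r big1 ?addr0 // => b.
by rewrite eq_sym => /negPf ->; rewrite !mul0r.
Qed.

Lemma Bmat_sym : ((Bmat L mu)^T)%R = Bmat L mu.
Proof.
apply/matrixP => a b; rewrite !mxE eq_sym minnC; congr (_ + _)%R.
by case: eqP => [->|]; rewrite ?mul0r.
Qed.

Lemma mean_formula l :
  (((h_ mu l)^T *m invmx (Bmat L mu) *m h_oo mu) ord0 ord0
   = \sum_a (@Hlen mu a)%:R * (invmx (Bmat L mu) *m h_ mu l) a ord0)%R.
Proof.
have -> : ((h_ mu l)^T *m invmx (Bmat L mu) = (invmx (Bmat L mu) *m h_ mu l)^T)%R.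
  by rewrite trmx_mul trmx_inv Bmat_sym.
by rewrite !mxE; apply: eq_bigr => a _; rewrite [(h_oo mu) _ _]mxE mulrC [in LHS]mxE.
Qed.

End Diagram.

(** * Lightness of the path, and conclusion *)

(* A balanced path would have energy L / 2 for a large capacity, which the
   positivity of the vacancy numbers excludes. *)
Lemma in_P_light L mu (p : L.-tuple letter) : 1 <= L ->
  (forall i : 'I_(g_ mu), (1 <= vacancy L i)%R) -> in_P mu p -> light (map ball p).
Proof.
move=> L_gt0 vac_gt0 [evp le21 enp]; set s := map ball p.
have es : size s = L by rewrite size_map size_tuple.
have e2 : nb s = count_mem two p by rewrite /nb count_map.
have e12 : count_mem Defs.one p + count_mem two p = L.
  rewrite -[RHS](size_tuple p) -(count_predC (pred1 two) p) addnC; congr (_ + _).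
  by apply: eq_count => c /=; case: (letterP c) => ->.
rewrite /light es; case: (ltngtP (2 * nb s) L) => // h; first by lia.
(* Load [L] in capacity [2 * L] keeps the carrier free throughout; on a balanced path it returns to
   [L]. *)
have [||pk ld] := @free_carrier (2 * L) L s; rewrite ?es; try lia.
have [|v ev] := @balls_surj (2 * L) L; first by lia.
have per_v : periodic_carrier p v by rewrite periodic_carrierE ev -/s; apply/eqP; lia.
have [|_ uniq_v] := evp (2 * L); first by lia.
(* Evolvability makes the energies independent of the periodic carrier, so [v] may be used to
   compute [E_]. *)
have Ep : E_ (2 * L) p = nb s.
  rewrite /E_; case: pickP => [w pw|/(_ v)]; last by rewrite per_v.
  have [_ ->] := uniq_v _ _ pw per_v.
  by have [_ _ ->] := transport_model v p; rewrite ev -/s pk.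
have := sum_Hlen_lt vac_gt0 L_gt0; have := enp (2 * L).
rewrite Ep -(sum_Hset mu (minn (2 * L))).
have : \sum_a minn (2 * L) (@Hlen mu a) <= \sum_a @Hlen mu a.
  by apply: leq_sum => a _; apply: geq_minr.
lia.
Qed.

Theorem proposition4p3 (L : nat) (hL : 1 <= L)
    (mu : seq nat) (hmu : young mu)
    (hvac : forall i : 'I_(g_ mu), (1 <= vacancy L i)%R)
    (p : L.-tuple letter) (hp : in_P mu p)
    (l : nat) (hl : 1 <= l) :
  let x (t : nat) : seq letter := iter t (T_ l) p in
  (forall t : nat, T_evolvable l (x t)) /\
  (exists y0 : nat -> row_tab l, exists N : nat,
    [/\ forall t : nat,
          unique (fun v : row_tab l => transport v (x t) = (x t.+1, v)) (y0 t),
        least_period (T_ l) (p : seq letter) N,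
        Bmat L mu \in unitmx &
        forall k : nat, k <= L ->
          let y (t : nat) : nat := balls (transport (y0 t) (take k (x t))).2 in
          (N%:R^-1 * (\sum_(0 <= t < N) (y t)%:R)
           = ((h_ mu l)^T *m invmx (Bmat L mu) *m h_oo mu) ord0 ord0
           :> rat)%R]).
Proof.
move=> x; have hs := in_P_light hL hvac hp; set s := map ball p in hs.
have es : size s = L by rewrite size_map size_tuple.
have hx t : light (map ball (x t)) by rewrite map_ball_iter_T // light_iter.
split=> [t|]; first exact: light_T_evolvable.
have ex_y0 t : exists v : row_tab l, balls v == car l (map ball (x t)).
  by have [v E] := balls_surj (car_le l (map ball (x t))); exists v; rewrite E.
pose y0 t := xchoose (ex_y0 t).
have y0E t : balls (y0 t) = car l (map ball (x t)) by exact/eqP/(xchooseP (ex_y0 t)).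
have [N [perN perN']] := least_period_T l hs; exists y0, N; split=> //.
- move=> t; have [v [ev uv _ _]] := light_T_E l (hx t).
  by rewrite (_ : y0 t = v) //; apply: balls_inj; rewrite y0E ev.
- exact: Bmat_unit.
move=> k le_k y; case: hp => _ _ enp.
(* The energies are prescribed from capacity 1 on; at capacity 0 both sides are 0. *)
have enE j : energ j s = \sum_a minn j (@Hlen mu a).
  case: j => [|j]; first by rewrite big1 ?/energ ?picks0 // => a _; rewrite min0n.
  have [v [_ _ _ <-]] := light_T_E j.+1 hs.
  by rewrite enp // (sum_Hset mu (minn j.+1)).
(* A capacity [M] no smaller than the number of balls and every row saturates both the energy and
   the minima. *)
have nbE : nb s = \sum_a @Hlen mu a.
  pose M := maxn (nb s) (\sum_a @Hlen mu a).
  rewrite -(energ_nb hs (leq_maxl _ _ : nb s <= M)) enE; apply: eq_bigr => a _.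
  apply/minn_idPr; rewrite /M (bigD1 a) //=; lia.
have := Bmat_soliton_eq hvac l; rewrite -{1}es => hphi.
have := mean_load hs perN' k nbE enE hphi.
rewrite mean_formula big_mkord -natr_sum => E.
have -> : \sum_(t < N) y t
  = \sum_(t < N) load l (car l (iter t (evol l) s)) (take k (iter t (evol l) s)).
  apply: eq_bigr => t _; rewrite /y.
  have [_ -> _] := transport_model (y0 t) (take k (x t)).
  by rewrite y0E map_take map_ball_iter_T.
by rewrite E mulKf // pnatr_eq0 -lt0n; case: perN.
Qed.
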